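(* Let $X$ be a subshift over a finite alphabet $\mathcal{A}$. Then for every integer $n \geq 1$, $$\left|\mathrm{Aut}^{(FIP)}_{\lfloor (n-1)/2 \rfloor}(X, \sigma)\right| \leq \left(c_{1+c_n(X)}(X)\right)^{2|\mathcal{A}| (c_{n+1}(X) - c_n(X))}.$$
   Context: The full shift $\mathcal{A}^{\mathbb{Z}}$ carries the product topology of the discrete topology, and the left shift $\sigma$ is defined by $(\sigma x)(n) = x(n+1)$. A subshift over $\mathcal{A}$ is a closed subset $X \subset \mathcal{A}^{\mathbb{Z}}$ invariant under $\sigma$ (i.e. $\sigma(X)=X$). The language $L(X)$ is the set of all finite words occurring as subwords (blocks of consecutive letters) of points of $X$; $L_n(X) = L(X)\cap \mathcal{A}^n$; and $c_n(X) = |L_n(X)|$. An automorphism of $X$ is a homeomorphism $\phi: X \to X$ with $\phi\circ\sigma = \sigma\circ\phi$; these form a group $\mathrm{Aut}(X,\sigma)$ under composition. For an integer $N \ge 0$, an automorphism $\phi$ has range $N$ if there is a map $\Phi: \mathcal{A}^{2N+1} \to \mathcal{A}$ with $(\phi x)(i) = \Phi(x(i-N) x(i-N+1)\cdots x(i+N))$ for all $x \in X$ and $i \in \mathbb{Z}$ (the range is not unique; $N$ need not be minimal). A point $x\in X$ is periodic if there is $p\ge 1$ with $x(i+p)=x(i)$ for all $i \in \mathbb{Z}$; an isolated periodic point of $X$ is a periodic point of $X$ which is an isolated point of the topological space $X$. $\mathrm{Aut}^{(FIP)}(X,\sigma)$ is the subgroup of $\mathrm{Aut}(X,\sigma)$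 consisting of automorphisms which fix every isolated periodic point of $X$ (so it equals $\mathrm{Aut}(X,\sigma)$ if there are no such points), and $\mathrm{Aut}^{(FIP)}_N(X,\sigma)$ is the set of elements of $\mathrm{Aut}^{(FIP)}(X,\sigma)$ which have range $N$. *)

(* Defs.v *)
From HB Require Import structures.
From mathcomp Require Import all_boot all_order all_algebra.
From mathcomp Require Import all_classical topology function_spaces.

Set Implicit Arguments.
Unset Strict Implicit.
Unset Printing Implicit Defensive.

Import GRing.Theory.

Local Open Scope classical_set_scope.
Local Open Scope card_scope.
Local Open Scope ring_scope.

Definition full_shift (A : finType) : topologicalType :=
  {ptws int -> discrete_topology A}.

Definition shift (A : finType) (x : full_shift A) : full_shift A :=
  fun i => x (i + 1).

(* Through the coercions to [set] and then to [set_type], a subshift X is also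
   the subtype of its points, with the subspace topology. *)
Record subshift (A : finType) := Subshift {
  points :> set (full_shift A);
  subshift_closed : closed points;
  subshift_invariant : @shift A @` points = points
}.

Lemma shift_in (A : finType) (X : subshift A) (x : X) :
  shift (val x) \in (X : set (full_shift A)).
Proof.
have : [set shift y | y in X] (shift (val x)).
  by exists (val x) => //; exact/set_mem/valP.
by rewrite subshift_invariant => /mem_set.
Qed.

Definition subshift_shift (A : finType) (X : subshift A) (x : X) : X :=
  exist _ (shift (val x)) (shift_in x).

(* The block x(i) x(i+1) ... x(i+n-1). *)
Definition block (A : finType) (x : full_shift A) (i : int) (n : nat) :
    n.-tuple A :=
  [tuple x (i + k%:Z) | k < n].

Definition language (A : finType) (X : subshift A) : set (seq A) :=
  [set w | exists (x : X) i n, w = tval (block (val x) i n)].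

Definition words (A : finType) (X : subshift A) (n : nat) : {set n.-tuple A} :=
  [set w : n.-tuple A | tval w \in language X]%SET.

Definition complexity (A : finType) (X : subshift A) (n : nat) : nat :=
  #|words X n|.

(* Hence the natural-number subtraction c_(n+1)(X) - c_n(X) never truncates. *)
Lemma leq_complexity (A : finType) (X : subshift A) (n : nat) :
  (complexity X n <= complexity X n.+1)%N.
Proof.
pose f (w : n.+1.-tuple A) : n.-tuple A :=
  [tuple tnth w (widen_ord (leqnSn n) k) | k < n].
suff : words X n \subset imset f (mem (words X n.+1)).
  by move=> /subset_leq_card/leq_trans; apply; exact: leq_imset_card.
apply/fintype.subsetP => w; rewrite inE => /set_mem[x [i [m wE]]].
have mn : m = n by have := congr1 size wE; rewrite !size_tuple.
subst m; apply/imsetP; exists (block (val x) i n.+1).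
  by rewrite inE; apply/mem_set; exists x, i, n.+1.
by rewrite (val_inj wE); apply: eq_from_tnth => k; rewrite !tnth_mktuple.
Qed.

Definition periodic (A : finType) (x : full_shift A) : Prop :=
  exists2 p : nat, (1 <= p)%N & forall i, x (i + p%:Z) = x i.

Definition homeomorphism (T U : topologicalType) (f : T -> U) : Prop :=
  exists g : U -> T,
    [/\ cancel f g, cancel g f, continuous f & continuous g].

Definition automorphisms (A : finType) (X : subshift A) : set (X -> X) :=
  [set phi | homeomorphism phi /\
             phi \o @subshift_shift A X = @subshift_shift A X \o phi].
Arguments automorphisms {A} X.

Definition has_range (A : finType) (X : subshift A) (N : nat) (phi : X -> X) :
    Prop :=
  exists Phi : (2 * N + 1).-tuple A -> A, forall (x : X) (i : int),
    val (phi x) i = Phi (block (val x) (i - N%:Z) (2 * N + 1)).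

Definition automorphisms_FIP (A : finType) (X : subshift A) : set (X -> X) :=
  [set phi | automorphisms X phi /\
     forall x : X, periodic (val x) -> isolated [set: X] x -> phi x = x].
Arguments automorphisms_FIP {A} X.

Definition automorphisms_FIP_range (A : finType) (X : subshift A) (N : nat) :
    set (X -> X) :=
  [set phi | automorphisms_FIP X phi /\ has_range N phi].
Arguments automorphisms_FIP_range {A} X.

(* Main.v *)
(* Points of X are bi-infinite walks in the Rauzy graph, whose vertices are the
   words of length n and whose edges are the words of length n + 1; an
   automorphism of range (n - 1) / 2 is determined by the letter that it
   attaches to each vertex.  Call a vertex special if it has several outgoing
   edges; there are at most c_(n+1) - c_n of these.  Between special vertices a
   walk is deterministic, so a vertex which some walk reaches after a special
   one lies at most c_n steps after a special edge, by the pigeonhole principle.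
   The same holds in the reversed graph.  Hence the images of one walk through
   each special edge, read over 1 + c_n positions, encode the letters at all
   these vertices.  At any other vertex the whole past and future are
   determined and recurrent, so that its walk is an isolated periodic point,
   which is fixed by assumption. *)
Require Import Defs.
From HB Require Import structures.
From mathcomp Require Import all_boot all_order all_algebra.
From mathcomp Require Import all_classical topology function_spaces.
From mathcomp Require Import zify.

Set Implicit Arguments.
Unset Strict Implicit.
Unset Printing Implicit Defensive.

Local Open Scope card_scope.

(** * Bounding a set by an injective code *)

Lemma card_le_fin (T : Type) (S : set T) (F : finType) (f : T -> F) :
  {in S &, injective f} -> S #<= `I_#|F|.
Proof.
move=> f_inj; pose g x : nat := enum_rank (f x).
have g_inj : {in S &, injective g}.
  by move=> x y Sx Sy /val_inj/enum_rank_inj/f_inj; apply.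
rewrite -(card_le_eql (inj_card_eq g_inj)).
by apply: subset_card_le => _ [x _ <-] /=; exact: ltn_ord.
Qed.

(* A family, indexed by T, of bi-infinite walks in a multigraph. *)
Record walks (T : Type) (V E : finType) := Walks {
  src : E -> V;
  tgt : E -> V;
  edge : T -> int -> E;
  tgt_edge : forall x i, tgt (edge x i) = src (edge x (i + 1)%R)
}.

(** * Special vertices and determinism of walks *)

Section Walks.
Variables (T : Type) (V E : finType) (G : walks T V E).

Definition vertex x i : V := src G (edge G x i).

Definition visited_edges : {set E} :=
  [set e | `[< exists x i, edge G x i = e >]].

Definition visited_vertices : {set V} := src G @: visited_edges.

Definition special : {set V} :=
  [set v | 1 < #|[set e in visited_edges | src G e == v]|]%N.

Definition special_edges : {set E} :=
  [set e in visited_edges | src G e \in special].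

Lemma visited_edgesP e :
  reflect (exists x i, edge G x i = e) (e \in visited_edges).
Proof. by rewrite inE; exact: asboolP. Qed.

Lemma edge_visited x i : edge G x i \in visited_edges.
Proof. by apply/visited_edgesP; exists x, i. Qed.

Lemma vertex_visited x i : vertex x i \in visited_vertices.
Proof. exact/imset_f/edge_visited. Qed.

Lemma edge_special x i :
  vertex x i \in special -> edge G x i \in special_edges.
Proof. by rewrite [in X in _ -> X]inE edge_visited. Qed.

Lemma vertexD1 x i : vertex x (i + 1)%R = tgt G (edge G x i).
Proof. by rewrite tgt_edge. Qed.

Lemma edge_determined x y i j :
  vertex x i \notin special -> vertex x i = vertex y j ->
  edge G x i = edge G y j.
Proof.
rewrite inE -leqNgt => /card_le1_eqP le1 xy.
by apply: le1; rewrite inE edge_visited /= ?eqxx //; apply/eqP/esym.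
Qed.

Lemma vertex_determined x y i j (t : nat) : vertex x i = vertex y j ->
  (forall s : nat, (s < t)%N -> vertex x (i + s%:Z)%R \notin special) ->
  vertex x (i + t%:Z)%R = vertex y (j + t%:Z)%R.
Proof.
move=> xy; elim: t => [|t IH] ns; first by rewrite !GRing.addr0.
have /edge_determined e : vertex x (i + t%:Z)%R \notin special by exact: ns.
rewrite -[t.+1]addn1 PoszD !GRing.addrA !vertexD1 (e y (j + t%:Z)%R) //.
by apply: IH => s st; apply: ns; lia.
Qed.

Lemma vertex_pigeonhole x i : exists s s' : nat,
  [/\ (s < s')%N, (s' <= #|visited_vertices|)%N &
      vertex x (i - s%:Z)%R = vertex x (i - s'%:Z)%R].
Proof.
pose f (s : 'I_#|visited_vertices|.+1) := vertex x (i - (val s)%:Z)%R.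
have /injectivePn[s [s' neq_ss' fss']] : ~~ injectiveb f.
  apply/negP => /injectiveP/card_imset fc.
  suff : (#|f @: 'I_#|visited_vertices|.+1| <= #|visited_vertices|)%N.
    by rewrite fc card_ord ltnn.
  apply/subset_leq_card/fintype.subsetP => _ /imsetP[s _ ->].
  exact: vertex_visited.
have := ltn_ord s; have := ltn_ord s'; rewrite !ltnS => s'c sc.
have [lt|gt|/val_inj eq] := ltngtP s s'; last by rewrite eq eqxx in neq_ss'.
- by exists s, s'.
- by exists s', s.
Qed.

(** Since [e] and [s] do not depend on the walk, any single walk through [e] shows this vertex
    within bounded time. Induction on [t] moves to the latest special vertex up to [i]; if that is
    too far back, a loop is cut out. *)
Lemma vertex_after_special x i (t : nat) : vertex x (i - t%:Z)%R \in special ->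
  exists2 e, e \in special_edges &
  exists2 s : nat, (s <= #|visited_vertices|)%N &
    forall y j, edge G y j = e -> vertex y (j + s%:Z)%R = vertex x i.
Proof.
elim/ltn_ind: t i => t IH i sp.
have [[s st sps]|nsp] :=
  pselect (exists2 s : nat, (s < t)%N & vertex x (i - s%:Z)%R \in special).
  exact: IH sps.
have {nsp} ns (s : nat) : (s < t)%N -> vertex x (i - s%:Z)%R \notin special.
  by move=> st; apply/negP => sps; apply: nsp; exists s.
have [tc|ct] := leqP t #|visited_vertices|.
  exists (edge G x (i - t%:Z)%R); first exact: edge_special.
  (* A special vertex leaves a choice, so determinism starts only at the target of [e], with one
     step fewer to go. *)
  exists t => // y j yj; case: t {IH tc} sp ns yj => [|t] sp ns yj.
    by rewrite GRing.addr0 /vertex yj GRing.subr0.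
  have -> : (j + t.+1%:Z = j + 1 + t%:Z)%R by lia.
  have e : vertex x (i - t.+1%:Z + 1)%R = vertex y (j + 1)%R.
    by rewrite !vertexD1 yj.
  rewrite -(vertex_determined (t := t) e); first by congr (vertex x _); lia.
  move=> s st; have -> : (i - t.+1%:Z + 1 + s%:Z = i - (t - s)%N%:Z)%R by lia.
  by apply: ns; lia.
have [s [s' [ss' s'c e]]] := vertex_pigeonhole x i.
(* The repetition lies after the special vertex, so following both copies for [s] steps shows the
   same vertex [s' - s] earlier, closer to the special one. *)
have -> : vertex x i = vertex x (i - (s' - s)%N%:Z)%R.
  have -> : (i - (s' - s)%N%:Z = i - s'%:Z + s%:Z)%R by lia.
  rewrite (vertex_determined (t := s) (esym e)); first by congr (vertex x _); lia.
  move=> u us; have -> : (i - s'%:Z + u%:Z = i - (s' - u)%N%:Z)%R by lia.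
  by apply: ns; lia.
apply: (IH (t - (s' - s))%N); first by lia.
by have -> : (i - (s' - s)%N%:Z - (t - (s' - s))%N%:Z = i - t%:Z)%R by lia.
Qed.

Definition forced_at v := forall x y i j, vertex x i = v -> vertex y j = v ->
  forall t : nat, vertex x (i + t%:Z)%R = vertex y (j + t%:Z)%R.

Definition recurs_at v (d : nat) := forall x i,
  vertex x i = v -> vertex x (i + d%:Z)%R = v.

(* The past of [vertex x i] is deterministic and repeats a vertex, so it lies on
   a cycle without special vertices, which no walk through it can leave. *)
Lemma forced_after_nonspecial x i :
  (forall t : nat, vertex x (i - t%:Z)%R \notin special) ->
  forced_at (vertex x i) /\ exists2 d, (0 < d)%N & recurs_at (vertex x i) d.
Proof.
move=> ns; have [s [s' [ss' s'c e]]] := vertex_pigeonhole x i.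
set w := vertex x i; pose d := (s' - s)%N.
have wd : vertex x (i - d%:Z)%R = w.
  have -> : (i - d%:Z = i - s'%:Z + s%:Z)%R by rewrite /d; lia.
  rewrite (vertex_determined (t := s) (esym e)).
    by congr (vertex x _); lia.
  move=> u us; have -> : (i - s'%:Z + u%:Z = i - (s' - u)%N%:Z)%R by lia.
  exact: ns.
have follow y j (t : nat) : vertex y j = w -> (t <= d)%N ->
    vertex y (j + t%:Z)%R = vertex x (i - d%:Z + t%:Z)%R.
  move=> yj td; rewrite (@vertex_determined x y _ j t) ?wd ?yj // => u ut.
  have -> : (i - d%:Z + u%:Z = i - (d - u)%N%:Z)%R by lia.
  exact: ns.
have rec : recurs_at w d.
  by move=> y j yj; rewrite follow // GRing.subrK.
have d_gt0 : (0 < d)%N by rewrite subn_gt0.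
split; last by exists d.
move=> y z j k yj zk t; elim/ltn_ind: t j k yj zk => t IH j k yj zk.
have [td|dt] := leqP t d; first by rewrite !follow.
have := IH (t - d)%N _ (j + d%:Z)%R (k + d%:Z)%R (rec _ _ yj) (rec _ _ zk).
have -> : (j + d%:Z + (t - d)%N%:Z = j + t%:Z)%R by lia.
have -> : (k + d%:Z + (t - d)%N%:Z = k + t%:Z)%R by lia.
by apply; lia.
Qed.

(** Out-degrees add up to the number of visited edges; each visited vertex contributes at least one,
    a special vertex at least two. *)
Lemma leq_card_special :
  (#|visited_vertices| + #|special| <= #|visited_edges|)%N.
Proof.
have spV : special \subset visited_vertices.
  apply/fintype.subsetP => v; rewrite inE => /ltnW/card_gt0P[e].
  by rewrite inE => /andP[eE /eqP <-]; exact: imset_f.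
rewrite -[leqRHS]sum1_card.
rewrite (partition_big (src G) (mem visited_vertices)); last first.
  by move=> e eE; exact: imset_f.
have -> : #|special| = (\sum_(v in visited_vertices) (v \in special))%N.
  rewrite -sum1_card big_mkcond [RHS]big_mkcond /=; apply: eq_bigr => v _.
  by case: ifPn => [/(fintype.subsetP spV) ->//|_]; case: ifP.
rewrite -sum1_card -big_split /=; apply: leq_sum => v vV.
have -> : (\sum_(e in visited_edges | src G e == v) 1 =
           #|[set e in visited_edges | src G e == v]|)%N.
  by rewrite -sum1_card; apply: eq_bigl => e; rewrite inE.
case: (boolP (v \in special)) => [|_]; first by rewrite inE.
rewrite addn0 card_gt0; apply/set0Pn; have /imsetP[e eE ->] := vV.
by exists e; rewrite inE eE eqxx.
Qed.

(** Labels separate edges of equal source, so each special vertex emits at most [#|A|] of them. *)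
Lemma card_special_edges (A : finType) (lab : E -> A) :
  injective (fun e => (src G e, lab e)) ->
  (#|special_edges| <= #|A| * (#|visited_edges| - #|visited_vertices|))%N.
Proof.
move=> lab_inj; rewrite -(card_imset _ lab_inj).
apply: (@leq_trans #|finset.setX special [set: A]%SET|).
  apply/subset_leq_card/fintype.subsetP => _ /imsetP[e + ->].
  by rewrite !inE => /andP[_ ->].
rewrite cardsX cardsT mulnC leq_mul2l leq_subRL ?leq_card_special ?orbT//.
exact: leq_trans (leq_addr _ _) leq_card_special.
Qed.

End Walks.

(** * Reversal of walks *)

Lemma reverse_subproof (T : Type) (V E : finType) (G : walks T V E) x i :
  src G (edge G x (- i - 1)%R) = tgt G (edge G x (- (i + 1) - 1)%R).
Proof. by rewrite tgt_edge; congr (src G (edge G x _)); lia. Qed.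

(** Unification with [reverse_subproof] fixes the fields: source and target are swapped and edge [i]
    is the old edge [- i - 1], whose target is the old vertex [- i]. *)
Definition reverse (T : Type) (V E : finType) (G : walks T V E) :
    walks T V E :=
  Walks (@reverse_subproof T V E G).

Lemma vertex_reverse (T : Type) (V E : finType) (G : walks T V E) x i :
  vertex (reverse G) x i = vertex G x (- i)%R.
Proof. by rewrite /vertex /= tgt_edge; congr (src G (edge G x _)); lia. Qed.

Lemma visited_edges_reverse (T : Type) (V E : finType) (G : walks T V E) :
  visited_edges (reverse G) = visited_edges G.
Proof.
apply/setP => e; apply/visited_edgesP/visited_edgesP => -[x [i <-]].
  by exists x, (- i - 1)%R.
by exists x, (- i - 1)%R => /=; congr (edge G x _); lia.
Qed.

Lemma visited_vertices_reverse (T : Type) (V E : finType) (G : walks T V E) :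
  visited_vertices (reverse G) = visited_vertices G.
Proof.
apply/setP => v; apply/imsetP/imsetP => -[e /visited_edgesP[x [i <-]] ->].
  exists (edge G x (- i)%R); first exact: edge_visited.
  by rewrite -[RHS]/(vertex G x (- i)%R) -vertex_reverse.
exists (edge (reverse G) x (- i)%R); first exact: edge_visited.
by rewrite -[RHS]/(vertex (reverse G) x (- i)%R) vertex_reverse GRing.opprK.
Qed.

(** * The Rauzy graph of a subshift *)

Definition prefix_word (A : finType) n (w : n.+1.-tuple A) : n.-tuple A :=
  [tuple tnth w (widen_ord (leqnSn n) k) | k < n].

Definition suffix_word (A : finType) n (w : n.+1.-tuple A) : n.-tuple A :=
  [tuple tnth w (lift ord0 k) | k < n].

Lemma prefix_word_block (A : finType) (x : full_shift A) i n :
  prefix_word (block x i n.+1) = block x i n.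
Proof. by apply: eq_from_tnth => k; rewrite !tnth_mktuple. Qed.

Lemma suffix_word_block (A : finType) (x : full_shift A) i n :
  suffix_word (block x i n.+1) = block x (i + 1)%R n.
Proof.
by apply: eq_from_tnth => k; rewrite !tnth_mktuple /=; congr x; rewrite /bump; lia.
Qed.

Lemma prefix_word_inj (A : finType) n :
  injective (fun w : n.+1.-tuple A => (prefix_word w, tnth w ord_max)).
Proof.
move=> u v uvE; have uv := congr1 fst uvE; have uvn := congr1 snd uvE.
apply: eq_from_tnth => k.
have [kn|] := ltnP k n.
  have := congr1 (fun w => tnth w (Ordinal kn)) uv; rewrite !tnth_mktuple.
  by have -> : widen_ord (leqnSn n) (Ordinal kn) = k by exact: val_inj.
move=> nk; have -> // : k = ord_max.
by apply: val_inj => /=; have := ltn_ord k; lia.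
Qed.

Lemma suffix_word_inj (A : finType) n :
  injective (fun w : n.+1.-tuple A => (suffix_word w, tnth w ord0)).
Proof.
move=> u v uvE; have uv := congr1 fst uvE; have uv0 := congr1 snd uvE.
apply: eq_from_tnth => k.
case: (unliftP ord0 k) => [j|] -> //.
by have := congr1 (fun w => tnth w j) uv; rewrite !tnth_mktuple.
Qed.

Lemma mem_words (A : finType) (X : subshift A) n (w : n.-tuple A) :
  w \in words X n <-> exists (x : X) i, block (val x) i n = w.
Proof.
rewrite inE; split => [/set_mem[x [i [m wE]]]|[x [i <-]]]; last first.
  by apply/mem_set; exists x, i, n.
have mn : m = n by have := congr1 size wE; rewrite !size_tuple.
by subst m; exists x, i; apply: val_inj; exact: (esym wE).
Qed.

Lemma rauzy_subproof (A : finType) (X : subshift A) n (x : X) i :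
  suffix_word (block (val x) i n.+1) =
  prefix_word (block (val x) (i + 1)%R n.+1).
Proof. by rewrite suffix_word_block prefix_word_block. Qed.

Definition rauzy (A : finType) (X : subshift A) n :
    walks X (n.-tuple A) (n.+1.-tuple A) :=
  Walks (@rauzy_subproof A X n).

Lemma vertex_rauzy (A : finType) (X : subshift A) n (x : X) i :
  vertex (rauzy X n) x i = block (val x) i n.
Proof. exact: prefix_word_block. Qed.

Lemma visited_edges_rauzy (A : finType) (X : subshift A) n :
  visited_edges (rauzy X n) = words X n.+1.
Proof.
by apply/setP => w; apply/visited_edgesP/idP => /mem_words.
Qed.

Lemma visited_vertices_rauzy (A : finType) (X : subshift A) n :
  visited_vertices (rauzy X n) = words X n.
Proof.
apply/setP => w; apply/imsetP/idP => [[e /visited_edgesP[x [i <-]] ->]|].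
  by apply/mem_words; exists x, i; rewrite /= prefix_word_block.
move=> /mem_words[x [i <-]]; exists (edge (rauzy X n) x i).
  exact: edge_visited.
by rewrite /= prefix_word_block.
Qed.

(** * Cylinder neighbourhoods and isolated periodic points *)

Lemma nbhs_block (A : finType) (X : subshift A) n (x : X) i :
  nbhs x [set y : X | block (val y) i n = block (val x) i n]%classic.
Proof.
have coord j : nbhs x [set y : X | val y j = val x j]%classic.
  have c : continuous (fun y : X => proj j (val y) : discrete_topology A).
    move=> y; apply: (@continuous_comp X (full_shift A)).
      exact: initial_continuous.
    exact: proj_continuous.
  exact: (c x _ (discrete_set1 (val x j : discrete_topology A))).
have := filter_forall (nbhs_filter x) (fun k : 'I_n => coord (i + (val k)%:Z)%R).
apply: filterS => y yx; apply: eq_from_tnth => k; rewrite !tnth_mktuple.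
exact: yx.
Qed.

Lemma eq_blocks (A : finType) n (x y : full_shift A) i j : (0 < n)%N ->
  (forall k : int, block x (i + k)%R n = block y (j + k)%R n) ->
  forall k : int, x (i + k)%R = y (j + k)%R.
Proof.
move=> n_gt0 xy k; have := congr1 (fun w => tnth w (Ordinal n_gt0)) (xy k).
by rewrite !tnth_mktuple /= !GRing.addr0.
Qed.

(** Forcing in both directions leaves a single point in the cylinder of this block, hence isolation;
    comparing [x] with itself [d] steps later gives the period. *)
Lemma forced_isolated (A : finType) (X : subshift A) n (x : X) i (d : nat) :
  (0 < n)%N -> (0 < d)%N ->
  forced_at (rauzy X n) (block (val x) i n) ->
  forced_at (reverse (rauzy X n)) (block (val x) i n) ->
  recurs_at (rauzy X n) (block (val x) i n) d ->
  periodic (val x) /\ isolated [set: X]%classic x.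
Proof.
move=> n_gt0 d_gt0 fwd bwd rec; set w := block _ _ _ in fwd bwd rec.
have determined (y z : X) j k : block (val y) j n = w ->
    block (val z) k n = w -> forall l, val y (j + l)%R = val z (k + l)%R.
  move=> yw zw; apply: (@eq_blocks A n) => // -[t|t].
    by rewrite -!vertex_rauzy; apply: fwd; rewrite vertex_rauzy.
  rewrite NegzE -[j]GRing.opprK -[k]GRing.opprK -!GRing.opprD.
  by rewrite -!vertex_rauzy -!vertex_reverse; apply: bwd;
     rewrite vertex_reverse GRing.opprK vertex_rauzy.
split.
  exists d => // j; have xd : block (val x) (i + d%:Z)%R n = w.
    by rewrite -vertex_rauzy; apply: rec; rewrite vertex_rauzy.
  have := determined x x _ _ xd erefl (j - i)%R.
  have -> : (i + d%:Z + (j - i) = j + d%:Z)%R by lia.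
  by have -> : (i + (j - i) = j)%R by lia.
split; first by rewrite in_setT.
exists [set y : X | block (val y) i n = w]%classic; first exact: nbhs_block.
apply/seteqP; split => [y [/= yw _]|y ->]; last by split.
apply: val_inj; apply/funext => j.
by rewrite -(GRing.subrK i j) GRing.addrC; exact: determined.
Qed.

(** * Local rules and the count of automorphisms *)

Lemma has_range_block (A : finType) (X : subshift A) N n (phi : X -> X) x y i j :
  (2 * N + 1 <= n)%N -> has_range N phi ->
  block (val x) i n = block (val y) j n ->
  val (phi x) (i + N%:Z)%R = val (phi y) (j + N%:Z)%R.
Proof.
move=> Nn [Phi phiE] xy; rewrite !phiE !GRing.addrK; congr Phi.
apply: eq_from_tnth => k; rewrite !tnth_mktuple.
by have := congr1 (fun w => tnth w (widen_ord Nn k)) xy; rewrite !tnth_mktuple.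
Qed.

(* [S #<= `I_m] states that S is finite with at most m elements. *)
Theorem theorem3p2 (A : finType) (X : subshift A) (n : nat) :
  (1 <= n)%N ->
  automorphisms_FIP_range X ((n - 1) %/ 2)%N #<=
    `I_(complexity X (1 + complexity X n)
        ^ (2 * #|A| * (complexity X (n + 1) - complexity X n)))%N.
Proof.
move=> n_gt0; set N := ((n - 1) %/ 2)%N; pose c := complexity X n.
have Nn : (2 * N + 1 <= n)%N by rewrite /N; lia.
pose G := rauzy X n; pose H := reverse G.
have wit (K : walks X (n.-tuple A) (n.+1.-tuple A))
    (e : {e | e \in special_edges K}) :
    {p : X * int | edge K p.1 p.2 = val e}.
  apply: cid; case: e => e /=; rewrite inE => /andP[/visited_edgesP[x [i <-]] _].
  by exists (x, i).
pose D := ({e | e \in special_edges G} + {e | e \in special_edges H})%type.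
(* The letter attached to the vertex at [i] sits at [i + N]. For [H], time runs backwards from
   [- p.2], so the window of length [1 + c] starts [c] places earlier and ends at [- p.2 + N]. *)
pose start (d : D) : X * int :=
  match d with
  | inl e => let p := sval (wit G e) in (p.1, p.2 + N%:Z)%R
  | inr e => let p := sval (wit H e) in (p.1, - p.2 - c%:Z + N%:Z)%R
  end.
have in_words (x : X) i : block (val x) i (1 + c) \in words X (1 + c).
  by apply/mem_words; exists x, i.
pose word (x : X) i : {w | w \in words X (1 + c)} :=
  exist (fun w => w \in words X (1 + c)) _ (in_words x i).
pose code (phi : X -> X) := [ffun d : D => word (phi (start d).1) (start d).2].
have code_inj : {in automorphisms_FIP_range X N &, injective code}.
  move=> phi psi /set_mem[[_ phi_fix] phiN] /set_mem[[_ psi_fix] psiN].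
  move=> /ffunP eq_code.
  have eq_start d (k : nat) : (k <= c)%N ->
      val (phi (start d).1) ((start d).2 + k%:Z)%R =
      val (psi (start d).1) ((start d).2 + k%:Z)%R.
    rewrite -ltnS => kc; have := congr1 val (eq_code d); rewrite !ffunE /=.
    by move=> /(congr1 (fun w => tnth w (Ordinal kc))); rewrite !tnth_mktuple.
  have eq_at x y i j : block (val y) j n = block (val x) i n ->
      val (phi y) (j + N%:Z)%R = val (psi y) (j + N%:Z)%R ->
      val (phi x) (i + N%:Z)%R = val (psi x) (i + N%:Z)%R.
    move=> yx; rewrite (has_range_block Nn phiN yx).
    by rewrite (has_range_block Nn psiN yx).
  apply/funext => x; apply: val_inj; apply/funext => l.
  rewrite -(GRing.subrK N%:Z%R l); move: (l - _)%R => i {l}.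
  (* First case: a vertex with several outgoing edges occurs at or before [i]. *)
  have [[t sp]|nspG] :=
      pselect (exists t : nat, vertex G x (i - t%:Z)%R \in special G).
    have [e eG [s sc evs]] := vertex_after_special sp.
    pose e' : {e | e \in special_edges G} := exist _ e eG.
    have := evs _ _ (svalP (wit G e')); rewrite !vertex_rauzy => /eq_at; apply.
    rewrite GRing.addrAC; apply: (eq_start (inl e')).
    by rewrite /c /complexity -visited_vertices_rauzy.
  (* Second case: a vertex with several incoming edges occurs at or after [i]. *)
  have [[t sp]|nspH] :=
      pselect (exists t : nat, vertex H x (- i - t%:Z)%R \in special H).
    have [e eH [s sc evs]] := vertex_after_special sp.
    pose e' : {e | e \in special_edges H} := exist _ e eH.
    have {}sc : (s <= c)%N.
      by rewrite visited_vertices_reverse visited_vertices_rauzy in sc.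
    have := evs _ _ (svalP (wit H e')).
    rewrite !vertex_reverse !vertex_rauzy GRing.opprK => /eq_at; apply.
    have := eq_start (inr e') (c - s)%N (leq_subr _ _).
    rewrite /start /=; case: (sval (wit H e')) => y j /=.
    by have -> : (- j - c%:Z + N%:Z + (c - s)%N%:Z = - (j + s%:Z) + N%:Z)%R by lia.
  (* Remaining case: [x] is an isolated periodic point, fixed by both [phi] and [psi]. *)
  have [|fwd [d d_gt0 rec]] := @forced_after_nonspecial _ _ _ G x i.
    by move=> t; apply/negP => sp; apply: nspG; exists t.
  have [|bwd _] := @forced_after_nonspecial _ _ _ H x (- i)%R.
    by move=> t; apply/negP => sp; apply: nspH; exists t.
  rewrite vertex_reverse GRing.opprK !vertex_rauzy in fwd bwd rec.
  have [per iso] := forced_isolated n_gt0 d_gt0 fwd bwd rec.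
  by rewrite phi_fix // psi_fix.
apply: (card_le_trans (card_le_fin code_inj)).
rewrite card_le_II card_ffun card_sum !card_sig addn1.
(* The label of an edge is its last letter in [G] and its first letter in [H]. *)
have Gc : (#|special_edges G| <= #|A| * (complexity X n.+1 - complexity X n))%N.
  have := card_special_edges
    (@prefix_word_inj A n : injective (fun e => (src G e, _))).
  by rewrite visited_edges_rauzy visited_vertices_rauzy.
have Hc : (#|special_edges H| <= #|A| * (complexity X n.+1 - complexity X n))%N.
  have := card_special_edges
    (@suffix_word_inj A n : injective (fun e => (src H e, _))).
  rewrite visited_edges_reverse visited_vertices_reverse.
  by rewrite visited_edges_rauzy visited_vertices_rauzy.
have abc : (#|special_edges G| + #|special_edges H| <=
    2 * #|A| * (complexity X n.+1 - complexity X n))%N by lia.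
(* Monotonicity in the exponent needs a positive base. Base zero means that [X] is empty, and then
   both exponents vanish. *)
have [c0|c_gt0] := posnP (complexity X (1 + complexity X n)).
  have diff0 : complexity X n.+1 = 0%N.
    apply: eq_card0 => w; apply/negP => /mem_words[x _].
    by have := card0_eq c0 (block (val x) 0%R (1 + c)); rewrite in_words.
  by move: abc; rewrite diff0 sub0n muln0 leqn0 => /eqP ->.
exact: leq_pexp2l.
Qed.
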